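(* Fix $d\geq 3$. For each $n$ let $A_n \subseteq [n]=\{1,\dots,n\}$, with $|A_n| \to \infty$, and suppose the elements of $A_n$ are colored independently and uniformly at random with $c_n$ colors, where $c_n\to\infty$, such that for all $3 \leq r \leq d$ there exists a constant $\lambda_r \geq 0$ with $$\lim_{n \to \infty}\mathbb{E}\, W_r(A_n) = \lim_{n \to \infty}\mathrm{Var}\, W_r(A_n) = \lambda_r.$$ Then, as $n \to \infty$, $(W_3(A_n), \ldots, W_d(A_n))^\top$ converges in distribution to $(Z_3, \ldots, Z_d)^\top$, where $Z_3 \sim \mathrm{Pois}(\lambda_3), \ldots, Z_d \sim \mathrm{Pois}(\lambda_d)$ are independent.
   Context: An $r$-term arithmetic progression ($r$-AP) in $A_n$ is a set of $r$ distinct equally spaced integers, all belonging to $A_n$. It is monochromatic if all its elements have the same color. $W_r(A_n)$ is the number of monochromatic $r$-APs in $A_n$ (all $W_r(A_n)$, $3\le r\le d$, are computed from the same random coloring, in which each element independently receives a uniform color in $\{1,\dots,c_n\}$). $\mathrm{Pois}(0)$ is the point mass at $0$. *)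

(* Defs.v *)
From HB Require Import structures.
From mathcomp Require Import all_boot all_order all_algebra finmap.
From mathcomp Require Import all_classical all_reals all_analysis.

Set Implicit Arguments.
Unset Strict Implicit.
Unset Printing Implicit Defensive.

Import Order.TTheory GRing.Theory Num.Theory.
Import numFieldNormedType.Exports.

Local Open Scope classical_set_scope.
Local Open Scope ring_scope.

(* For a positive common difference b, the r terms are automatically distinct. *)
Definition is_AP (r : nat) (S : {fset nat}) : Prop :=
  exists a b : nat,
    (0 < b)%N /\ S = [fset (a + b * val i)%N | i in 'I_r]%fset.

Definition monochromatic (col : nat -> nat) (S : {fset nat}) : Prop :=
  forall x y, x \in S -> y \in S -> col x = col y.

(* Progressions are counted as subsets of A, so that a progression and its
   reversal are the same object. *)
Definition num_mono_AP (r : nat) (A : {fset nat}) (col : nat -> nat) : nat :=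
  #|` [fset S in fpowerset A | `[< is_AP r S /\ monochromatic col S >]]%fset |.

Definition mutually_independent (d d' : measure_display) (T : measurableType d)
    (U : measurableType d') (R : realType) (P : probability T R)
    (I : choiceType) (J : set I) (X : I -> T -> U) : Prop :=
  forall (K : {fset I}) (B : I -> set U),
    [set` K] `<=` J -> (forall i, measurable (B i)) ->
    P (\bigcap_(i in [set` K]) (X i @^-1` B i)) =
    (\prod_(i <- K) P (X i @^-1` B i))%E.

(* The colour of a point x is w |-> X w x; it matters only for x in A. *)
Definition uniform_random_coloring (d : measure_display) (T : measurableType d)
    (R : realType) (P : probability T R) (A : {fset nat}) (c : nat)
    (X : T -> nat -> nat) : Prop :=
  [/\ forall x, x \in A -> measurable_fun [set: T] (fun w => X w x),
      forall x j, x \in A -> (1 <= j <= c)%N ->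
        P [set w | X w x = j] = (c%:R^-1)%:E
    & mutually_independent P [set` A] (fun x w => X w x)].

(* The second argument of poisson_prob is not used by its definition; the
   law of rate 0 is the Dirac mass at 0. *)
Definition has_poisson_law (d : measure_display) (T : measurableType d)
    (R : realType) (P : probability T R) (Z : {RV P >-> nat}) (rate : R) : Prop :=
  forall B : set nat, distribution P Z B = poisson_prob rate 0%N B.

(* The random elements X n may live on different probability spaces. *)
Definition cvg_in_distribution (R : realType)
    (disp : nat -> measure_display) (T : forall n, measurableType (disp n))
    (P : forall n, probability (T n) R)
    (d : measure_display) (T' : measurableType d) (Q : probability T' R)
    (S : topologicalType) (X : forall n, T n -> S) (Y : T' -> S) : Prop :=
  forall f : S -> R, continuous f -> bounded_fun f ->
    'E_(P n)[f \o X n]%E @[n --> \oo] --> 'E_Q[f \o Y]%E.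

(* Main.v *)
Require Import Defs.
From HB Require Import structures.
From mathcomp Require Import all_boot all_order all_algebra finmap.
From mathcomp Require Import all_classical all_reals all_analysis.
From mathcomp Require Import zify ring lra.

Set Implicit Arguments.
Unset Strict Implicit.
Unset Printing Implicit Defensive.

Import Order.TTheory GRing.Theory Num.Theory.
Import numFieldNormedType.Exports.

Local Open Scope classical_set_scope.
Local Open Scope ring_scope.

(** Let N_r be the number of r-term progressions in A_n, and c = c_n. The points of
    an r-set get a common colour with probability c^(1-r), so E W_r = N_r / c^(r-1).
    A progression is determined by its first three terms, hence N_r <= N_3 and
    E W_r <= (N_3 / c^2) / c for r > 3. As N_3 / c^2 = E W_3 converges and c tends to
    infinity, E W_r tends to 0: for r > 3 the number lambda_r is 0, Z_r vanishes almost
    surely, and W_r vanishes with probability tending to 1 ([cvg_mean_long],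
    [prob_nonzero_le_mean]). Both vectors therefore live, asymptotically, on the axis
    of their first coordinate, and what is left is to show that W_3 converges to the
    Poisson law of parameter lambda_3 ([cvg_in_distribution_one_coord]).

    The 3-term progressions form a hypergraph whose edges have three points and in
    which two points lie in at most 3 common edges. Take any such hypergraph with N
    edges, put mu = N / c^2, and let W count the monochromatic edges of a uniform
    colouring chi. If an edge S is recoloured with the colour of one of its points
    v_S, the result chi^S is uniform among the colourings that are constant on S. So
        (k+1) P(W(chi) = k+1) = c^(-2) sum_S P(W(chi^S) = k+1),
    and the right-hand side is close to mu P(W = k) as soon as recolouring S raises W
    by exactly one for most pairs (S, chi). This can fail only if S was monochromatic
    before, or if some other edge through a point u of S with u <> v_S is
    monochromatic before or after; the cost is governed by the sum over S of the
    degrees of these u. For a star, where all edges share one point, this sum is small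
    only if v_S is the centre, so v_S is taken of maximal degree in S. Then, calling u
    heavy if its degree is at least c, a heavy u <> v_S forces v_S to be heavy; there
    are at most 3N/c heavy points, and two of them share a bounded number of edges, so
    that the sum is O(cN + N^2/c) ([sum_degree_light]). The outcome is
        (k+1) P(W = k+1) - mu P(W = k) = O(1/c)
    ([mono_count_law_rec]). Together with tightness, which is Markov's inequality for
    W, this recursion forces P(W = k) to converge to exp(-lambda_3) lambda_3^k / k!
    ([poisson_limit]). *)

(** * Recolouring a set of points with a single colour *)

Section Monochromatic.
Local Open Scope nat_scope.
Variables (V : finType) (C : eqType).
Implicit Types (col : V -> C) (S : {set V}).

Definition mono_on col S : bool := [forall x in S, forall y in S, col x == col y].

Lemma mono_onP col S :
  reflect {in S &, forall x y, col x = col y} (mono_on col S).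
Proof.
apply: (iffP forall_inP) => [h x y xS yS|h x xS].
  by move/forall_inP: (h x xS) => /(_ y yS)/eqP.
by apply/forall_inP => y yS; apply/eqP/h.
Qed.

Definition mono_count (I : finType) (e : I -> {set V}) col :=
  #|[pred i | mono_on col (e i)]|.

End Monochromatic.

Section Recoloring.
Local Open Scope nat_scope.
Variables (V : finType) (c : nat).
Implicit Types (U S : {set V}) (chi : {ffun V -> 'I_c}).

Definition recolor U v chi : {ffun V -> 'I_c} :=
  [ffun x => if x \in U then chi v else chi x].

Lemma mono_on_recolor U v chi : mono_on (recolor U v chi) U.
Proof. by apply/mono_onP => x y xU yU; rewrite !ffunE xU yU. Qed.

(** Recolouring forgets the colours of the points of U other than v, and nothing
    else: each colouring that is constant on U has c^(|U|-1) preimages. *)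
Lemma card_recolor U v (Q : pred {ffun V -> 'I_c}) : v \in U ->
  #|[pred chi : {ffun V -> 'I_c} | Q (recolor U v chi)]| =
  c ^ #|U|.-1 * #|[pred chi : {ffun V -> 'I_c} | mono_on chi U && Q chi]|.
Proof.
move=> vU; rewrite -[LHS]sum1_card.
rewrite (partition_big (recolor U v) [pred psi : {ffun V -> 'I_c} | mono_on psi U && Q psi]) /=;
  last by move=> chi; rewrite inE => ->; rewrite mono_on_recolor.
rewrite mulnC -sum_nat_const; apply: eq_bigr => psi /andP[/mono_onP mpsi Qpsi].
rewrite sum1_card.
(* The fibre over psi: the colour is free on U :\ v and prescribed elsewhere. *)
pose F (x : V) : {pred 'I_c} :=
  [pred a | (x \in U :\ v) || (a == psi x)].
rewrite (@eq_card _ _ (family F)); last first.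
  move=> chi; rewrite inE; apply/andP/familyP => [[_ /eqP rec x]|h].
    rewrite !inE -rec !ffunE; case: (eqVneq x v) => [->|]; first by rewrite vU eqxx.
    by case: (x \in U); rewrite ?eqxx ?orbT.
  suff rec : recolor U v chi = psi by rewrite inE rec eqxx Qpsi.
  have chv : chi v = psi v.
    by have := h v; rewrite !inE eqxx /= => /eqP.
  apply/ffunP => x; rewrite ffunE; case: ifPn => [xU|xU].
    by rewrite chv; exact: mpsi.
  by have := h x; rewrite !inE (negbTE xU) andbF /= => /eqP.
rewrite card_family foldrE big_map big_enum /=.
rewrite (bigID (fun x => x \in U :\ v)) /=.
rewrite (eq_bigr (fun=> c)); last first.
  move=> x xU; rewrite -[RHS](card_ord c); apply: eq_card => a.
  by rewrite inE xU.
rewrite prod_nat_const -[RHS]muln1; congr (_ * _).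
  by congr (_ ^ _); rewrite (cardsD1 v U) vU.
rewrite big1 // => x xU; rewrite -(card1 (psi x)).
by apply: eq_card => a; rewrite inE (negbTE xU).
Qed.

Lemma card_mono_on U : 0 < #|U| ->
  c ^ #|U|.-1 * #|[pred chi : {ffun V -> 'I_c} | mono_on chi U]| = c ^ #|V|.
Proof.
move=> /card_gt0P[v vU]; have := card_recolor xpredT vU.
have -> : #|[pred chi : {ffun V -> 'I_c} | true]| = c ^ #|V|.
  by rewrite -[in RHS](card_ord c) -card_ffun; apply: eq_card.
move->; congr (_ * _); apply: eq_card => chi.
by rewrite !inE andbT.
Qed.

End Recoloring.

Section Hypergraph.
Local Open Scope nat_scope.
Variables (V I : finType) (c : nat) (e : I -> {set V}).
Implicit Types (chi : {ffun V -> 'I_c}) (i j : I) (u v : V).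

Definition degree u := #|[pred i | u \in e i]|.

Definition recolor_edge (rep : I -> V) i := @recolor V c (e i) (rep i).

Lemma sum_mono_count r : 0 < r -> (forall i, #|e i| = r) ->
  c ^ r.-1 * \sum_(chi : {ffun V -> 'I_c}) mono_count e chi = #|I| * c ^ #|V|.
Proof.
move=> r0 er; under eq_bigr do rewrite /mono_count -sum1_card big_mkcond.
rewrite exchange_big big_distrr /= -sum_nat_const; apply: eq_bigr => i _.
rewrite -(@card_mono_on V c (e i)) ?er//; congr (_ * _).
by rewrite -big_mkcond sum1_card; apply: eq_card.
Qed.

Lemma sum_degree r : (forall i, #|e i| = r) -> \sum_u degree u = r * #|I|.
Proof.
move=> er; under eq_bigr do rewrite /degree -sum1_card big_mkcond.
rewrite exchange_big /= mulnC -sum_nat_const; apply: eq_bigr => i _.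
by rewrite -big_mkcond sum1_card -(er i); apply: eq_card.
Qed.

(** Size biasing: for a uniform chi, the recoloured chi is uniform among the
    colourings that make edge i monochromatic. Summing over i turns the condition
    into a weight mono_count chi, which equals k on the event considered. *)
Lemma sum_mono_count_recolor r rep k : (forall i, #|e i| = r) ->
  (forall i, rep i \in e i) ->
  \sum_i #|[pred chi : {ffun V -> 'I_c} | mono_count e (recolor_edge rep i chi) == k]| =
  c ^ r.-1 * (k * #|[pred chi : {ffun V -> 'I_c} | mono_count e chi == k]|).
Proof.
move=> er rin.
under eq_bigr => i _ do rewrite
  (@card_recolor V c (e i) (rep i) (fun chi => mono_count e chi == k) (rin i)) er.
rewrite -big_distrr /=; congr (_ * _).
under eq_bigr do rewrite -sum1_card big_mkcond.
rewrite exchange_big /= mulnC -sum_nat_const [RHS]big_mkcond /=.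
apply: eq_bigr => chi _; rewrite -big_mkcond /= unfold_in.
case: ifPn => [/eqP <-|/negbTE h].
  by rewrite sum1_card; apply: eq_card => i; rewrite !unfold_in /= eqxx andbT.
by rewrite big_pred0 // => i; rewrite !unfold_in /= h andbF.
Qed.

(** An edge j can change status only if it meets e i in a point other than rep i,
    whose colour is kept. If such an edge is monochromatic afterwards, its points
    outside e i already had the colour of rep i. *)
Lemma mono_count_recolor rep chi i : (forall i, rep i \in e i) ->
  (mono_count e (recolor_edge rep i chi) != (mono_count e chi).+1) <=
  mono_on chi (e i) + \sum_(j | (j != i) && (e j :&: (e i :\ rep i) != finset.set0))
    (mono_on chi (e j) + mono_on chi (rep i |: e j :\: e i)).
Proof.
move=> rin; set v := rep i.
case: (boolP (mono_on chi (e i))) => [_|nmi]; first by case: (_ != _).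
set s := \sum_(_ | _) _.
case: (posnP s) => [s0|]; last by case: (_ != _).
rewrite s0 add0n leqn0 eqb0 negbK; apply/eqP.
rewrite /mono_count -!sum1_card big_mkcond [in RHS]big_mkcond /=.
rewrite (bigD1 i) //= [in RHS](bigD1 i) //=.
rewrite !inE mono_on_recolor (negbTE nmi) add0n add1n.
congr _.+1; apply: eq_bigr => j ji; rewrite !inE; congr (if _ then _ else _).
case: (boolP (e j :&: (e i :\ v) != finset.set0)) => hj.
  move: s0 => /eqP; rewrite sum_nat_eq0 => /forallP /(_ j); rewrite ji hj /=.
  rewrite addn_eq0 !eqb0 => /andP[/negbTE -> /negP h].
  apply/negP => /mono_onP m; apply: h; apply/mono_onP.
  case/finset.set0Pn: hj => x; rewrite !inE => /and3P[xj xv xi].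
  have key y : y \in v |: e j :\: e i -> chi y = chi v.
    rewrite !inE => /orP[/eqP -> //|/andP[yi yj]].
    by have := m y x yj xj; rewrite !ffunE (negbTE yi) xi.
  by move=> y z /key -> /key ->.
have agree x : x \in e j -> recolor_edge rep i chi x = chi x.
  move=> xj; rewrite ffunE; case: ifP => // xi.
  case: (eqVneq x v) => [->//|xv]; case/negP: hj; apply/finset.set0Pn.
  by exists x; rewrite !inE xj xv xi.
by apply/mono_onP/mono_onP => m x y xj yj; have := m x y xj yj; rewrite !agree.
Qed.

End Hypergraph.

(** * Recolouring an edge of a 3-uniform hypergraph at a point of maximal degree *)

Section TripleSystem.
Local Open Scope nat_scope.
Variables (V I : finType) (c K : nat) (e : I -> {set V}).
Hypothesis e3 : forall i, #|e i| = 3.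
Hypothesis e_inj : injective e.
Hypothesis codegree : forall u v, u != v ->
  #|[pred i | (u \in e i) && (v \in e i)]| <= K.
Implicit Types (chi : {ffun V -> 'I_c}) (i j : I) (u v : V).

(** Union bound over the events of [mono_count_recolor]. If e j meets e i in one
    point, both events attached to j have probability c^(-2). If they share two
    points, the second event only asks that the third point of e j agree with rep i;
    it has probability c^(-1), whence the last term. *)
Lemma card_recolor_defect rep i : (forall i, rep i \in e i) ->
  c ^ 2 * #|[pred chi : {ffun V -> 'I_c} |
    mono_count e (recolor_edge e rep i chi) != (mono_count e chi).+1]| <=
  c ^ #|V| * (1 + 2 * (\sum_(u in e i :\ rep i) degree e u)
     + c * \sum_(j | j != i) (1 < #|e j :&: e i|)).
Proof.
move=> rin; set v := rep i.
have hm U : \sum_(chi : {ffun V -> 'I_c}) (mono_on chi U : nat) =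
    #|[pred chi : {ffun V -> 'I_c} | @mono_on V 'I_c chi U]|.
  by rewrite -sum1_card [RHS]big_mkcond; apply: eq_bigr => chi _; rewrite inE; case: mono_on.
rewrite -sum1_card big_mkcond /=.
set D := fun j => (j != i) && (e j :&: (e i :\ v) != finset.set0).
apply: (@leq_trans (c ^ 2 * \sum_(chi : {ffun V -> 'I_c}) (mono_on chi (e i) + \sum_(j | D j)
    (mono_on chi (e j) + mono_on chi (v |: e j :\: e i))))).
  rewrite leq_mul2l; apply/orP; right; apply: leq_sum => chi _; rewrite inE.
  by have := mono_count_recolor chi i rin; case: (_ != _).
rewrite big_split /= exchange_big /= hm.
under eq_bigr do rewrite big_split /= !hm.
have m3 j : c ^ 2 * #|[pred chi : {ffun V -> 'I_c} | @mono_on V 'I_c chi (e j)]| = c ^ #|V|.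
  by have := @card_mono_on V c (e j); rewrite e3 => ->.
have D_le (F : I -> nat) : \sum_(j | D j) F j <= \sum_(j | j != i) F j.
  by rewrite big_mkcondr; apply: leq_sum => j _; case: ifP.
rewrite mulnDr big_distrr /= m3 mulnDr mulnDr muln1 -addnA leq_add2l.
apply: (@leq_trans (\sum_(j | D j) c ^ #|V| * (2 + c * (1 < #|e j :&: e i|)))).
  apply: leq_sum => j /andP[ji Dj].
  rewrite mulnDr m3 -(addnA 1 1) mulnDr muln1 leq_add2l.
  have cDI := cardsID (e i) (e j); rewrite e3 in cDI.
  have cI : 0 < #|e j :&: e i|.
    case/finset.set0Pn: Dj => x; rewrite !inE => /and3P[xj _ xi].
    by apply/card_gt0P; exists x; rewrite inE xj.
  have cD : 0 < #|e j :\: e i|.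
    rewrite card_gt0; apply: contra ji; rewrite finset.setD_eq0 => sub.
    by apply/eqP/e_inj/eqP; rewrite eqEcard sub !e3.
  have cU : #|v |: e j :\: e i| = (#|e j :\: e i|).+1.
    by rewrite cardsU1 !inE (rin i).
  have := @card_mono_on V c (v |: e j :\: e i); rewrite cU => /(_ isT) /=.
  set m := #|[pred chi : {ffun V -> 'I_c} | _]|; move: cDI cI cD.
  case: #|_ :&: _| => // -[|[|a]] cDI _ cD /=.
  - have -> : #|e j :\: e i| = 2 by lia.
    by move=> ->; rewrite muln0 addn0 muln1.
  - have -> : #|e j :\: e i| = 1 by lia.
    by rewrite expn1 => <-; rewrite muln1; nia.
  - by lia.
under eq_bigr do rewrite mulnDr.
rewrite big_split /=; apply: leq_add; last first.
  rewrite [X in _ <= _ * X]big_distrr /= big_distrr /=.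
  exact: D_le.
rewrite -big_distrr /= leq_mul2l; apply/orP; right.
rewrite big_distrr /= /degree.
under [leqRHS]eq_bigr do rewrite -sum1_card big_mkcond big_distrr /=.
rewrite exchange_big /= big_mkcond; apply: leq_sum => j _.
rewrite /D; case: ifP => // /andP[_ /finset.set0Pn[x]].
rewrite inE => /andP[xj xi]; rewrite (bigD1 x) //= inE xj muln1.
exact: leq_addr.
Qed.

(** An edge j counted here passes through one of the 9 ordered pairs of points of
    e i, and each pair of distinct points lies in at most K edges. *)
Lemma sum_overlap i :
  \sum_(j | j != i) (1 < #|e j :&: e i|) <= 9 * K.
Proof.
have -> : 9 * K = \sum_(u in e i) \sum_(v in e i) K.
  by rewrite !sum_nat_const e3 mulnA.
apply: (@leq_trans (\sum_(u in e i) \sum_(v in e i)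
   \sum_j [&& u != v, u \in e j & v \in e j])); last first.
  apply: leq_sum => u _; apply: leq_sum => v _.
  case: (eqVneq u v) => [uv|uv]; first by rewrite big1.
  apply: leq_trans (codegree uv); rewrite -sum1_card [leqRHS]big_mkcond /=.
  by apply: leq_sum => j _; rewrite inE; case: (_ && _).
under [leqRHS]eq_bigr do rewrite exchange_big /=.
rewrite [leqRHS]exchange_big /= [X in X <= _]big_mkcond; apply: leq_sum => j _.
case: ifP => // ji; case: (ltnP 1) => // /card_gt1P[u [v [ui vi uv]]].
move: ui vi; rewrite !inE => /andP[uj ui] /andP[vj vi].
rewrite (bigD1 u) //= (bigD1 v) //= uv uj vj /=.
by rewrite -addnA leq_addr.
Qed.

(** The threshold c balances the two terms of [sum_degree_light] when the number
    of edges is of order c^2. *)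
Definition heavy u := c <= degree e u.

Lemma card_heavy : c * #|heavy| <= 3 * #|I|.
Proof.
rewrite -(sum_degree e3) mulnC -sum_nat_const.
rewrite [leqRHS](bigID heavy) /=; apply: leq_trans (leq_addr _ _).
by apply: leq_sum => u; rewrite unfold_in.
Qed.

(** Light points contribute at most c each. If u in e i is heavy and differs from
    rep i, then rep i is heavy as well, because its degree is at least that of u; so i
    is among the at most K edges through u and some other heavy point, and the heavy
    contributions add up to at most K #|heavy| times the sum of all degrees. *)
Lemma sum_degree_light rep : (forall i, rep i \in e i) ->
  (forall i u, u \in e i -> degree e u <= degree e (rep i)) ->
  \sum_i \sum_(u in e i :\ rep i) degree e u
    <= 2 * c * #|I| + 3 * K * #|I| * #|heavy|.
Proof.
move=> rin rmax.
apply: (@leq_trans (\sum_i \sum_(u in e i :\ rep i)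
   (c + \sum_(v in heavy) [&& u != v, u \in e i & v \in e i] * degree e u))).
  apply: leq_sum => i _; apply: leq_sum => u; rewrite !inE => /andP[uv ui].
  case: (leqP c (degree e u)) => cu; last exact: (leq_trans (ltnW cu) (leq_addr _ _)).
  rewrite (bigD1 (rep i)) /=; last by rewrite unfold_in (leq_trans cu) ?rmax.
  by rewrite uv ui rin mul1n addnCA leq_addr.
under eq_bigr do rewrite big_split /=.
rewrite big_split /=; apply: leq_add.
  rewrite [leqRHS]mulnC -sum_nat_const; apply: leq_sum => i _.
  by rewrite sum_nat_const; have := cardsD1 (rep i) (e i); rewrite rin e3 add1n => -[<-].
apply: (@leq_trans (\sum_i \sum_u \sum_(v in heavy)
   [&& u != v, u \in e i & v \in e i] * degree e u)).
  by apply: leq_sum => i _; rewrite big_mkcond; apply: leq_sum => u _; case: ifP.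
rewrite exchange_big /=.
have -> : 3 * K * #|I| * #|heavy| = \sum_u \sum_(v in heavy) K * degree e u.
  rewrite exchange_big mulnC -sum_nat_const; apply: eq_bigr => v _.
  by rewrite -big_distrr /= (sum_degree e3) mulnCA mulnA.
apply: leq_sum => u _; rewrite exchange_big /=; apply: leq_sum => v _.
rewrite -big_distrl leq_mul2r; apply/orP; right.
case: (eqVneq u v) => [uv|uv]; first by rewrite big1.
apply: leq_trans (codegree uv); rewrite -sum1_card [leqRHS]big_mkcond /=.
by apply: leq_sum => j _; rewrite inE; case: (_ && _).
Qed.

Lemma max_degree_rep :
  exists rep : I -> V, (forall i, rep i \in e i) /\
    (forall i u, u \in e i -> degree e u <= degree e (rep i)).
Proof.
have h i : exists v, (v \in e i) && [forall u in e i, degree e u <= degree e v].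
  have /card_gt0P[u0 u0i] : 0 < #|e i| by rewrite e3.
  exists [arg max_(v > u0 | v \in e i) degree e v].
  case: arg_maxnP => // v vi vmax; apply/andP; split => //.
  by apply/forall_inP => u ui; exact: vmax.
exists (fun i => xchoose (h i)); split => [i|i u ui].
  by case/andP: (xchooseP (h i)).
by case/andP: (xchooseP (h i)) => _ /forall_inP; exact.
Qed.

Lemma sum_recolor_defect : exists rep : I -> V, (forall i, rep i \in e i) /\
  c ^ 3 * \sum_i #|[pred chi : {ffun V -> 'I_c} |
    mono_count e (recolor_edge e rep i chi) != (mono_count e chi).+1]| <=
  c ^ #|V| * (c * #|I| + 2 * (2 * c ^ 2 * #|I| + 9 * K * #|I| ^ 2)
     + 9 * K * c ^ 2 * #|I|).
Proof.
have [rep [rin rmax]] := max_degree_rep; exists rep; split => //.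
set B := \sum_i _.
have hB : c ^ 2 * B <= c ^ #|V| * (#|I| + 2 * (2 * c * #|I| + 3 * K * #|I| * #|heavy|)
    + c * (9 * K * #|I|)).
  rewrite big_distrr /=.
  apply: leq_trans.
    by apply: leq_sum => i _; exact: card_recolor_defect i rin.
  rewrite -big_distrr /= leq_mul2l; apply/orP; right.
  rewrite big_split /= big_split /= -!big_distrr /= sum1_card; apply: leq_add.
    by rewrite leq_add2l leq_mul2l sum_degree_light.
  rewrite leq_mul2l; apply/orP; right.
  apply: leq_trans.
    by apply: leq_sum => i _; exact: sum_overlap.
  by rewrite sum_nat_const mulnC.
have hH := card_heavy.
rewrite (expnS c 2) -mulnA; apply: (leq_trans (leq_mul (leqnn c) hB)).
rewrite mulnCA leq_mul2l; apply/orP; right.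
have : 3 * K * #|I| * (c * #|heavy|) <= 3 * K * #|I| * (3 * #|I|).
  by rewrite leq_mul2l hH orbT.
move: #|heavy| #|I| => h N; lia.
Qed.

End TripleSystem.

(** * The law of the number of monochromatic edges *)

Section AlmostPoisson.
Variables (R : realFieldType) (V I : finType) (c K : nat) (e : I -> {set V}).
Hypothesis c_gt0 : (0 < c)%N.
Hypothesis e3 : forall i, #|e i| = 3.
Hypothesis e_inj : injective e.
Hypothesis codegree : forall u v, u != v ->
  (#|[pred i | (u \in e i) && (v \in e i)]| <= K)%N.
Implicit Types (chi : {ffun V -> 'I_c}) (i j : I) (u v : V).

Definition mono_count_law k : R :=
  #|[pred chi : {ffun V -> 'I_c} | mono_count e chi == k]|%:R / (c ^ #|V|)%:R.

(** By [sum_mono_count_recolor] the two terms are averages over the edges, with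
    weight mu, of the probabilities that W = k+1 after recolouring the edge and that
    W = k before. For each edge these differ at most by the probability that
    recolouring does not raise W by exactly one. *)
Lemma mono_count_law_rec k (mu := #|I|%:R / c%:R ^+ 2) :
  `|k.+1%:R * mono_count_law k.+1 - mu * mono_count_law k|
    <= (5%:R * mu + 18%:R * K%:R * mu ^+ 2 + 9%:R * K%:R * mu) / c%:R.
Proof.
have [rep [rin hB]] := sum_recolor_defect c e3 e_inj codegree.
set B := (\sum_i _)%N in hB.
have hR := @sum_mono_count_recolor V I c e 3 rep k.+1 e3 rin.
set a := fun k => #|[pred chi : {ffun V -> 'I_c} | mono_count e chi == k]|.
have hN : (\sum_(i : I) a k = #|I| * a k)%N by rewrite sum_nat_const.
set bad := fun i => #|[pred chi : {ffun V -> 'I_c} |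
    mono_count e (recolor_edge e rep i chi) != (mono_count e chi).+1]|.
have le1 : (c ^ 2 * (k.+1 * a k.+1) <= #|I| * a k + B)%N.
  rewrite -hR -hN -big_split /=; apply: leq_sum => i _.
  rewrite /a -cardUI; apply: leq_trans (leq_addr _ _).
  apply/subset_leq_card/fintype.subsetP => chi; rewrite !inE => /eqP ->.
  by rewrite eqSS eq_sym; case: (_ == _).
have le2 : (#|I| * a k <= c ^ 2 * (k.+1 * a k.+1) + B)%N.
  rewrite -hR -hN -big_split /=; apply: leq_sum => i _.
  rewrite /a -cardUI; apply: leq_trans (leq_addr _ _).
  apply/subset_leq_card/fintype.subsetP => chi; rewrite !inE => /eqP ->.
  by case: (_ == _).
rewrite /mono_count_law -!/(a _).
have O0 : (0 < c ^ #|V|)%N by rewrite expn_gt0 c_gt0.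
move: le1 le2 hB; rewrite -!(ler_nat R) !(natrD, natrM, natrX).
move: O0; rewrite -(ltr_nat R) natrX.
rewrite -[(#|I|)%:R](divfK (_ : c%:R ^+ 2 != 0 :> R)); last first.
  by rewrite expf_neq0 // pnatr_eq0 -lt0n.
rewrite -/mu; have : 0 <= mu by rewrite divr_ge0 ?exprn_ge0.
have : 1 <= c%:R :> R by rewrite (ler_nat R 1).
move: (c%:R : R) (c%:R ^+ #|V| : R) ((a k)%:R : R) ((a k.+1)%:R : R) (B%:R : R).
move: (k.+1%:R : R) (K%:R : R) (ler0n R K) => m k' k'0 C O x y b C1 mu0 O0 h1 h2 h3.
have C0 : 0 < C by lra.
have -> : m * (y / O) - mu * (x / O) = (C ^+ 2 * (m * y) - mu * C ^+ 2 * x) / (O * C ^+ 2).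
  by field; rewrite !gt_eqF.
rewrite normrM (ger0_norm (_ : 0 <= (O * C ^+ 2)^-1)); last first.
  by rewrite invr_ge0 mulr_ge0 ?exprn_ge0 // ltW.
rewrite ler_pdivrMr; last by rewrite mulr_gt0 ?exprn_gt0.
have hb : `|C ^+ 2 * (m * y) - mu * C ^+ 2 * x| <= b.
  by rewrite ler_norml; apply/andP; split; lra.
apply: (le_trans hb); rewrite -(ler_pM2l (_ : 0 < C ^+ 3)) ?exprn_gt0 //.
apply: (le_trans h3).
have -> : C ^+ 3 * ((5 * mu + 18 * k' * mu ^+ 2 + 9 * k' * mu) / C * (O * C ^+ 2))
  = O * ((5 * mu + 18 * k' * mu ^+ 2 + 9 * k' * mu) * C ^+ 4).
  by field; rewrite gt_eqF.
rewrite ler_pM2l //.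
have : mu * C ^+ 3 <= mu * C ^+ 4.
  by rewrite ler_wpM2l // (exprS _ 3) ler_peMl // exprn_ge0 // ltW.
lra.
Qed.

End AlmostPoisson.

Section LawTail.
Variables (R : realFieldType) (V I : finType) (c r : nat) (e : I -> {set V}).
Hypothesis c_gt0 : (0 < c)%N.
Hypothesis r_gt0 : (0 < r)%N.
Hypothesis er : forall i, #|e i| = r.

Lemma mono_count_law_ge0 k : 0 <= mono_count_law R c e k.
Proof. exact: divr_ge0. Qed.

Let card_colorings_gt0 : (0 : R) < (c ^ #|V|)%:R.
Proof. by rewrite ltr0n expn_gt0 c_gt0. Qed.

Lemma sum_mono_count_law m : \sum_(k < m) mono_count_law R c e k =
  1 - #|[pred chi : {ffun V -> 'I_c} | (m <= mono_count e chi)%N]|%:R / (c ^ #|V|)%:R.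
Proof.
apply/eqP; rewrite eq_sym subr_eq -mulr_suml -mulrDl -natr_sum -natrD.
suff -> : (\sum_(k < m) #|[pred chi : {ffun V -> 'I_c} | mono_count e chi == k]| +
    #|[pred chi : {ffun V -> 'I_c} | (m <= mono_count e chi)%N]| = c ^ #|V|)%N.
  by rewrite divff // gt_eqF.
transitivity #|{: {ffun V -> 'I_c}}|; last by rewrite card_ffun card_ord.
rewrite -(cardC [pred chi : {ffun V -> 'I_c} | (m <= mono_count e chi)%N]) addnC.
congr (_ + _)%N.
under eq_bigr do rewrite -sum1_card big_mkcond.
rewrite exchange_big -sum1_card [RHS]big_mkcond; apply: eq_bigr => chi _.
rewrite !inE -ltnNge; case: ltnP => h.
  rewrite (bigD1 (Ordinal h)) //= inE eqxx big1 // => k; rewrite inE.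
  by rewrite -val_eqE /= eq_sym; case: eqP.
rewrite big1 // => k _; rewrite inE; case: eqP => // hk.
by move: (ltn_ord k); rewrite -hk ltnNge h.
Qed.

Lemma sum_mono_count_law_le1 m : \sum_(k < m) mono_count_law R c e k <= 1.
Proof. by rewrite sum_mono_count_law gerBl divr_ge0. Qed.

(** Markov's inequality for the number of monochromatic edges. *)
Lemma mono_count_law_tail m :
  m%:R * (1 - \sum_(k < m) mono_count_law R c e k) <= #|I|%:R / c%:R ^+ r.-1.
Proof.
rewrite sum_mono_count_law opprB addrC subrK mulrA ler_pdivrMr //.
rewrite mulrAC ler_pdivlMr ?exprn_gt0 ?ltr0n // -natrX -!natrM ler_nat.
rewrite -(@sum_mono_count V I c e r r_gt0 er) mulnC leq_mul2l; apply/orP; right.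
rewrite mulnC -sum_nat_const [leqRHS](bigID [pred chi : {ffun V -> 'I_c} | (m <= mono_count e chi)%N]) /=.
by apply: leq_trans (leq_addr _ _); apply: leq_sum => chi; rewrite inE.
Qed.

End LawTail.

(** * Arithmetic progressions as a hypergraph *)

Section ArithmeticProgressions.
Local Open Scope nat_scope.

Definition AP (r a b : nat) : {fset nat} := [fset (a + b * val i)%N | i in 'I_r]%fset.

Lemma memAPP r a b x :
  reflect (exists2 i, i < r & x = a + b * i) (x \in AP r a b).
Proof.
apply: (iffP (imfsetP _ _ _ _)) => [[i _ ->]|[i ir ->]]; first by exists i.
by exists (Ordinal ir).
Qed.

Lemma card_AP r a b : 0 < b -> #|` AP r a b| = r.
Proof.
move=> b0; rewrite card_imfset /= ?size_enum_ord //.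
by move=> i j /addnI/eqP; rewrite eqn_mul2l gtn_eqF //= => /eqP/val_inj.
Qed.

Lemma AP3_inj a b a' b' : 0 < b -> 0 < b' -> AP 3 a b = AP 3 a' b' ->
  a = a' /\ b = b'.
Proof.
move=> b0 b0' E.
have /memAPP[i i3 hi] : a \in AP 3 a' b' by rewrite -E; apply/memAPP; exists 0; lia.
have /memAPP[i' i3' hi'] : a' \in AP 3 a b by rewrite E; apply/memAPP; exists 0; lia.
have /memAPP[j j3 hj] : a + b \in AP 3 a' b' by rewrite -E; apply/memAPP; exists 1; lia.
have /memAPP[j' j3' hj'] : a' + b' \in AP 3 a b by rewrite E; apply/memAPP; exists 1; lia.
have ea : a = a' by lia.
subst a'; split => //.
case: j j3 hj => [|j] _ hj; first lia.
case: j' j3' hj' => [|j'] _ hj'; first lia.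
rewrite !mulnS in hj hj'; lia.
Qed.

(** The three candidates have x and y as first and second, second and third, and
    first and third terms. If x.*2 < y or if y - x is odd, truncation makes the
    second or the third candidate meaningless; the list is only an upper bound. *)
Lemma AP3_through x y S : x < y -> is_AP 3 S -> x \in S -> y \in S ->
  S \in [:: AP 3 x (y - x); AP 3 (x.*2 - y) (y - x); AP 3 x (y - x)./2].
Proof.
move=> xy [a [b [b0 ->]]] /memAPP[i i3 hi] /memAPP[j j3 hj].
have E a' b' : a = a' -> b = b' -> AP 3 a b == AP 3 a' b' by move=> -> ->.
rewrite !inE; apply/or3P.
case: i i3 hi => [|[|[|//]]] _ hi; case: j j3 hj => [|[|[|//]]] _ hj; try lia.
- by constructor 1; apply: E; lia.
- by constructor 3; apply: E; lia.
- by constructor 2; apply: E; lia.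
Qed.

Variable A : {fset nat}.

Definition APs r : {fset {fset nat}} := [fset S in fpowerset A | `[< is_AP r S >]]%fset.

Definition AP_edge r (i : APs r) : {set A} := [set x : A | val x \in val i]%SET.

Lemma APs_sub r (i : APs r) : (val i `<=` A)%fset.
Proof. by case: i => S /=; rewrite !inE /= fpowersetE => /andP[]. Qed.

Lemma APs_is_AP r (i : APs r) : is_AP r (val i).
Proof. by case: i => S /=; rewrite !inE /= => /andP[_ /asboolP]. Qed.

Lemma card_AP_edge r (i : APs r) : #|AP_edge i| = r.
Proof.
have [a [b [b0 Ei]]] := APs_is_AP i.
rewrite -[RHS](card_AP r a b0) /AP -Ei card_fset_sum1.
have -> : val i = [fset x in A | x \in val i]%fset.
  by apply/fsetP => x; rewrite !inE /= andb_idl // => /(fsubsetP (APs_sub i)).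
rewrite -big_fset_condE big_seq_fsetE sum1_card; apply: eq_card => x.
by rewrite !inE.
Qed.

Lemma AP_edge_inj r : injective (@AP_edge r).
Proof.
move=> i j /setP E; apply/val_inj/fsetP => x.
have [xA|xA] := boolP (x \in A); first by have := E [` xA]%fset; rewrite !inE.
have h (k : APs r) : x \in val k = false.
  by apply/negbTE/(contra _ xA) => /(fsubsetP (APs_sub k)).
by rewrite !h.
Qed.

Lemma AP_edge_codegree (u v : A) : u != v ->
  #|[pred i | (u \in @AP_edge 3 i) && (v \in AP_edge i)]| <= 3.
Proof.
wlog uv : u v / val u < val v.
  move=> h uv; case: (ltngtP (val u) (val v)) => [/h|/h|/val_inj e]; first exact.
    by rewrite eq_sym => /(_ uv); apply: leq_trans; apply/subset_leq_card/fintype.subsetP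
      => i; rewrite !inE andbC.
  by rewrite e eqxx in uv.
move=> _; rewrite cardE -(size_map val).
apply: leq_trans (uniq_leq_size (s2 := [:: AP 3 (val u) (val v - val u);
  AP 3 ((val u).*2 - val v) (val v - val u); AP 3 (val u) (val v - val u)./2]) _ _) => //.
  by rewrite map_inj_uniq ?enum_uniq //; exact: val_inj.
move=> S /mapP[i]; rewrite mem_enum !inE => /andP[ui vi] ->.
have := AP3_through uv (APs_is_AP i) ui vi.
by rewrite !inE.
Qed.

(** Cutting a progression after its third term is injective: what remains
    determines the first term and the common difference. *)
Lemma card_APs_le r : 3 <= r -> #|{: APs r}| <= #|{: APs 3}|.
Proof.
move=> r3.
have h (i : APs r) : exists j : APs 3, exists a b,
    [/\ 0 < b, val i = AP r a b & val j = AP 3 a b].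
  have [a [b [b0 Ei]]] := APs_is_AP i.
  have jP : AP 3 a b \in APs 3.
    rewrite !inE /= fpowersetE; apply/andP; split; last by apply/asboolP; exists a, b.
    apply: fsubset_trans (APs_sub i); apply/fsubsetP => x /memAPP[k k3 ->].
    by rewrite Ei; apply/memAPP; exists k => //; exact: leq_trans r3.
  by exists [` jP]%fset, a, b.
have [f fP] := choice h.
apply: (@leq_card _ _ f) => i i' E.
have [a [b [b0 Ei Ej]]] := fP i; have [a' [b' [b0' Ei' Ej']]] := fP i'.
have [ea eb] : a = a' /\ b = b' by apply: AP3_inj => //; rewrite -Ej -Ej' E.
by apply: val_inj; rewrite Ei Ei' ea eb.
Qed.

Lemma num_mono_AP_mono_count r (col : nat -> nat) (f : A -> nat) :
  (forall x, f x = col (val x)) ->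
  num_mono_AP r A col = mono_count (@AP_edge r) f.
Proof.
move=> fcol; rewrite /num_mono_AP.
have -> : [fset S in fpowerset A | `[< is_AP r S /\ monochromatic col S >]]%fset =
   [fset S in APs r | `[< monochromatic col S >]]%fset.
  apply/fsetP => S; rewrite !inE /= -andbA; congr (_ && _).
  by rewrite asbool_and.
rewrite card_fset_sum1 -big_fset_condE big_seq_fsetE sum1_card; apply: eq_card => i.
rewrite !inE; apply/asboolP/mono_onP => [h x y|h x y xi yi].
  by rewrite !inE !fcol => xi yi; exact: h.
have xA := fsubsetP (APs_sub i) x xi; have yA := fsubsetP (APs_sub i) y yi.
have := h [` xA]%fset [` yA]%fset; rewrite !fcol; apply; by rewrite inE.
Qed.

End ArithmeticProgressions.

(** * From random colourings to counting *)

(** A random vector with finitely many natural coordinates takes countably many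
    values, so that every event it defines is measurable. *)
Lemma measurable_ffun_preimage d (T : measurableType d) (V : finType)
    (Y : V -> T -> nat) (B : set {ffun V -> nat}) :
  (forall v, measurable_fun [set: T] (Y v)) ->
  measurable [set w | B [ffun v => Y v w]].
Proof.
move=> mY; have -> : [set w | B [ffun v => Y v w]] =
    \bigcup_(phi : {ffun V -> nat}) (\bigcap_(v in [set: V]) (Y v @^-1` [set phi v]) `&` [set _ | B phi]).
  apply/seteqP; split => w /=.
    by move=> Bw; exists [ffun v => Y v w] => //; split => // v _ /=; rewrite ffunE.
  move=> [phi _ [h Bphi]]; suff -> : [ffun v => Y v w] = phi by [].
  by apply/ffunP => v; rewrite ffunE; exact: h.
apply: countable_bigcupT_measurable; first exact: countableP.
move=> phi; apply: measurableI; last first.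
  have [h|h] := pselect (B phi).
    by rewrite (_ : [set _ | _] = setT) //; apply/seteqP; split.
  by rewrite (_ : [set _ | _] = set0) //; apply/seteqP; split.
apply: fin_bigcap_measurable; first exact: finite_finset.
by move=> v _; rewrite -[X in measurable X]setTI; exact: mY.
Qed.

Section ColoringLaw.
Variables (R : realType) (d : measure_display) (T : measurableType d).
Variables (P : probability T R) (A : {fset nat}) (c : nat) (X : T -> nat -> nat).
Hypothesis X_unif : uniform_random_coloring P A c X.
Hypothesis c_gt0 : (0 < c)%N.

Definition restrict_coloring (w : T) : {ffun A -> nat} := [ffun x => X w (val x)].

(** The random colours range over 1, ..., c, the elements of 'I_c over
    0, ..., c-1. *)
Definition shift_coloring (chi : {ffun A -> 'I_c}) : {ffun A -> nat} :=
  [ffun x => (chi x).+1].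

Lemma measurable_coloring_event (B : set {ffun A -> nat}) :
  measurable [set w | B (restrict_coloring w)].
Proof.
apply: (@measurable_ffun_preimage _ _ _ (fun x w => X w (val x))) => x.
by case: X_unif => mX _ _; exact: mX (valP x).
Qed.

Lemma prob_coloring_eq chi :
  P [set w | restrict_coloring w = shift_coloring chi] = (((c ^ #|{: A}|)%:R)^-1)%:E.
Proof.
case: X_unif => mX uX iX.
pose B (x : nat) : set nat := [set j | exists2 y : A, val y = x & j = (chi y).+1].
have -> : [set w | restrict_coloring w = shift_coloring chi] =
    \bigcap_(x in [set` A]) ((fun w => X w x) @^-1` B x).
  apply/seteqP; split => w /=.
    move=> h x xA; exists [` xA]%fset => //.
    by have /ffunP/(_ [` xA]%fset) := h; rewrite !ffunE.
  move=> h; apply/ffunP => x; rewrite !ffunE.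
  by have [y /val_inj <-] := h (val x) (valP x).
rewrite (iX A B) //.
rewrite (eq_big_seq (fun=> (c%:R^-1)%:E)); last first.
  move=> x xA; rewrite -(uX x (chi [` xA]%fset).+1 xA) ?ltn_ord //.
  congr (P _); apply/seteqP; split => w /=.
    by move=> [y yx ->]; congr (nat_of_ord (chi _)).+1; apply/val_inj.
  by move=> ->; exists [` xA]%fset.
rewrite prodEFin; congr EFin.
by rewrite big_const_seq count_predT iter_mulr_1 exprVn natrX cardfE.
Qed.

(** The c^|A| colourings with values in 1, ..., c are disjoint events of equal
    probability, so the counting ratio of B is a lower bound for its probability.
    The same holds for the complement of B, and the two ratios add up to 1; hence both
    bounds are equalities, and colourings with other values carry no mass. *)
Lemma prob_coloring_event (B : set {ffun A -> nat}) :
  P [set w | B (restrict_coloring w)] =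
  (#|[pred chi | `[< B (shift_coloring chi) >]]|%:R / (c ^ #|{: A}|)%:R)%:E.
Proof.
pose q (B : set {ffun A -> nat}) : R :=
  #|[pred chi | `[< B (shift_coloring chi) >]]|%:R / (c ^ #|{: A}|)%:R.
have lower B' : ((q B')%:E <= P [set w | B' (restrict_coloring w)])%E.
  pose F chi := [set w | restrict_coloring w = shift_coloring chi /\ B' (shift_coloring chi)].
  have mF chi : measurable (F chi).
    exact: (measurable_coloring_event
      [set phi | phi = shift_coloring chi /\ B' (shift_coloring chi)]).
  apply: (@le_trans _ _ (P (\bigcup_(chi in setT) F chi))); last first.
    apply: le_measure; rewrite ?inE.
    - by apply: fin_bigcup_measurable => //; exact: finite_finset.
    - exact: measurable_coloring_event.
    - by move=> w [chi _ [/= -> ]].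
  rewrite measure_fin_bigcup //; last 2 first.
    exact: finite_finset.
    apply/trivIsetP => chi chi' _ _ /eqP ne; apply/seteqP; split => // w [[e _] [e' _]].
    apply: ne; apply/ffunP => x; apply/val_inj.
    by move: e'; rewrite e => /ffunP/(_ x); rewrite !ffunE => -[].
  rewrite (_ : [set: _] = [set` index_enum {ffun A -> 'I_c}]); last first.
    by apply/seteqP; split => // chi _ /=; rewrite mem_index_enum.
  rewrite -fsbig_seq ?index_enum_uniq //.
  have PF chi : P (F chi) = (if `[< B' (shift_coloring chi) >] then ((c ^ #|{: A}|)%:R)^-1 else 0)%:E.
    case: asboolP => h.
      rewrite -(prob_coloring_eq chi); congr (P _).
      by apply/seteqP; split => w /= => [[]|].
    rewrite (_ : F chi = set0) ?measure0 //.
    by apply/seteqP; split => w // [].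
  rewrite (eq_bigr _ (fun chi _ => PF chi)).
  by rewrite sumEFin -big_mkcond sumr_const /q lee_fin mulr_natl.
have compl : q B + q (~` B) = 1.
  rewrite /q -mulrDl -natrD.
  rewrite (_ : (_ + _)%N = (c ^ #|{: A}|)%N) ?divff //.
    by rewrite pnatr_eq0 -lt0n expn_gt0 c_gt0.
  have <- : #|{: {ffun A -> 'I_c}}| = (c ^ #|{: A}|)%N by rewrite card_ffun card_ord.
  rewrite -(cardC [pred chi | `[< B (shift_coloring chi) >]]); congr (_ + _)%N.
  by apply: eq_card => chi; rewrite !inE asbool_neg.
have lB := lower B; have lC := lower (~` B).
have mB := measurable_coloring_event B.
have hC : P [set w | (~` B) (restrict_coloring w)] = (1 - P [set w | B (restrict_coloring w)])%E.
  by rewrite -probability_setC.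
move: lB lC; rewrite hC -(fineK (fin_num_measure P _ mB)) -EFinB !lee_fin => lB lC.
by congr EFin; apply/eqP; rewrite eq_le -/(q B) lB andbT; lra.
Qed.

End ColoringLaw.

Section ProgressionCounts.
Variables (R : realType) (d : measure_display) (T : measurableType d).
Variables (P : probability T R) (A : {fset nat}) (c : nat) (X : T -> nat -> nat).
Hypothesis X_unif : uniform_random_coloring P A c X.

Lemma mono_on_shift (chi : {ffun A -> 'I_c}) (S : {set A}) :
  mono_on (shift_coloring chi) S = mono_on chi S.
Proof.
apply/mono_onP/mono_onP => h x y xS yS; last by rewrite !ffunE (h x y).
by apply/val_inj; have := h x y xS yS; rewrite !ffunE => -[].
Qed.

Lemma num_mono_AP_restrict r w :
  num_mono_AP r A (X w) = mono_count (@AP_edge A r) (restrict_coloring A X w).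
Proof. by apply: num_mono_AP_mono_count => x; rewrite ffunE. Qed.

Lemma measurable_num_mono_AP r :
  measurable_fun [set: T] (fun w => num_mono_AP r A (X w)).
Proof.
move=> _ B _; rewrite setTI.
have := measurable_coloring_event X_unif
  [set phi | B (mono_count (@AP_edge A r) phi)].
by congr measurable; apply/seteqP; split => w /=; rewrite num_mono_AP_restrict.
Qed.

Hypothesis c_gt0 : (0 < c)%N.

Lemma prob_num_mono_AP r k : P [set w | num_mono_AP r A (X w) = k] =
  (mono_count_law R c (@AP_edge A r) k)%:E.
Proof.
pose B : set {ffun A -> nat} := [set phi | mono_count (@AP_edge A r) phi = k].
have -> : [set w | num_mono_AP r A (X w) = k] = [set w | B (restrict_coloring A X w)].
  by apply/seteqP; split => w /=; rewrite num_mono_AP_restrict.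
rewrite (prob_coloring_event X_unif c_gt0 B); congr (_ / _)%:E; congr (_%:R).
apply: eq_card => chi; rewrite !inE /=.
rewrite /B /= (_ : mono_count _ (shift_coloring chi) = mono_count (@AP_edge A r) chi).
  by apply/asboolP/eqP.
by apply: eq_card => i; rewrite !inE mono_on_shift.
Qed.

Lemma expectation_num_mono_AP r : (0 < r)%N ->
  'E_P[fun w => (num_mono_AP r A (X w))%:R]%E =
  (#|{: APs A r}|%:R / c%:R ^+ r.-1)%:E.
Proof.
move=> r0.
pose M (i : APs A r) := [set w | [set phi | mono_on phi (AP_edge i)] (restrict_coloring A X w)].
have mM i : measurable (M i).
  exact: (measurable_coloring_event X_unif [set phi | mono_on phi (AP_edge i)]).
have PM i : P (M i) = ((c%:R ^+ r.-1)^-1)%:E.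
  rewrite (prob_coloring_event X_unif c_gt0 [set phi | mono_on phi (AP_edge i)]); congr (_%:E).
  have := @card_mono_on A c (AP_edge i); rewrite card_AP_edge => /(_ r0) h.
  rewrite -h natrM invfM mulrCA (_ : #|_| = #|[pred chi : {ffun A -> 'I_c} | mono_on chi (AP_edge i)]|).
    rewrite divff ?mulr1 ?natrX // pnatr_eq0 -lt0n.
    by rewrite -(@ltn_pmul2l (c ^ r.-1)) ?muln0 ?h expn_gt0 c_gt0.
  apply: eq_card => chi; rewrite !inE /= mono_on_shift.
  exact: asboolb.
rewrite unlock.
transitivity (\int[P]_w (\sum_(i : APs A r) (\1_(M i) w)%:E))%E.
  apply: eq_integral => w _; rewrite sumEFin; congr EFin.
  rewrite num_mono_AP_restrict /mono_count -sum1_card natr_sum big_mkcond /=.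
  apply: eq_bigr => i _; rewrite inE indicE.
  by case: ifPn => h; [rewrite mem_set|rewrite memNset // => /=; apply/negP].
rewrite ge0_integral_sum //; last first.
  by move=> i; apply/measurable_realfun.measurable_EFinP; exact: measurable_realfun.measurable_indic.
rewrite (eq_bigr (fun=> ((c%:R ^+ r.-1)^-1)%:E)); last first.
  by move=> i _; rewrite integral_indic // setIT; exact: PM.
by rewrite sumEFin sumr_const mulr_natl.
Qed.

End ProgressionCounts.


(** * The Poisson limit of an approximate recursion *)

Lemma cvg_seq_ext (R : realType) (f g : nat -> R) (a b : R) :
  f =1 g -> a = b -> g n @[n --> \oo] --> b -> f n @[n --> \oo] --> a.
Proof. by move=> /funext -> ->. Qed.

Section PoissonLimit.
Variables (R : realType) (p : nat -> nat -> R) (mu err : nat -> R) (lam : R).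
Hypothesis lam_ge0 : 0 <= lam.
Hypothesis mu_lim : mu n @[n --> \oo] --> lam.
Hypothesis err_lim : err n @[n --> \oo] --> 0.
Hypothesis p_ge0 : forall n k, 0 <= p n k.
Hypothesis p_rec : \forall n \near \oo, forall k,
  `|k.+1%:R * p n k.+1 - mu n * p n k| <= err n.
Hypothesis p_sum : \forall n \near \oo, forall m, \sum_(k < m) p n k <= 1.
Hypothesis p_tail : \forall n \near \oo, forall m,
  m%:R * (1 - \sum_(k < m) p n k) <= mu n.

Let p_le1 : \forall n \near \oo, forall k, p n k <= 1.
Proof.
apply: filterS p_sum => n pn k; apply: le_trans (pn k.+1).
by rewrite big_ord_recr /= lerDr; apply: sumr_ge0.
Qed.

(** The recursion passes to the limit in n, and its exact solution is
    lam^k / k! times the value at 0. *)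
Lemma law_sub_poisson_cvg0 k :
  p n k - exp_coeff lam k * p n 0 @[n --> \oo] --> 0.
Proof.
elim: k => [|k IH].
  rewrite /exp_coeff /= expr0 fact0 invr1 mul1r.
  by apply: (cvg_seq_ext (g := fun=> 0)) (cvg_cst _) => // n; rewrite mul1r subrr.
have E n : p n k.+1 - exp_coeff lam k.+1 * p n 0 = k.+1%:R^-1 *
    ((k.+1%:R * p n k.+1 - mu n * p n k) + ((mu n - lam) * p n k
     + lam * (p n k - exp_coeff lam k * p n 0))).
  rewrite /exp_coeff /= exprS factS natrM.
  have f0 : (k`!)%:R != 0 :> R by rewrite pnatr_eq0 -lt0n fact_gt0.
  have k0 : k.+1%:R != 0 :> R by [].
  by field; rewrite f0 nat1r k0.
refine (cvg_seq_ext E (esym (mulr0 k.+1%:R^-1)) _).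
apply: cvgMl_tmp.
refine (cvg_seq_ext (fun=> erefl) (esym (addr0 0)) _); apply: cvgD.
  apply/cvgr0Pnorm_le => eps eps0.
  move/cvgr0Pnorm_le : err_lim => /(_ _ eps0) herr.
  near=> n; apply: (le_trans (y := err n)).
    by move: (k); near: n.
  by apply: (le_trans (ler_norm _)); near: n.
refine (cvg_seq_ext (fun=> erefl) (esym (addr0 0)) _); apply: cvgD; last first.
  refine (cvg_seq_ext (fun=> erefl) (esym (mulr0 lam)) _).
  exact: cvgMl_tmp.
have mu0 : mu n - lam @[n --> \oo] --> 0.
  by refine (cvg_seq_ext (fun=> erefl) (esym (subrr lam)) _); apply: cvgB => //; exact: cvg_cst.
apply/cvgr0Pnorm_le => eps eps0.
move/cvgr0Pnorm_le : mu0 => /(_ _ eps0) hmu.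
near=> n; rewrite normrM -[leRHS]mulr1; apply: ler_pM => //.
  by near: n.
by rewrite ger0_norm //; move: (k); near: n.
Unshelve. all: by end_near. Qed.

(** The masses p n k with k < m add up to p n 0 times a partial sum of the
    exponential series, up to o(1), and to 1, up to a tail of order 1/m. So
    exp(lam) p n 0 tends to 1. *)
Lemma law_0_cvg : p n 0 @[n --> \oo] --> expR (- lam).
Proof.
have sum_lim m : \sum_(k < m) p n k - series (exp_coeff lam) m * p n 0
    @[n --> \oo] --> 0.
  rewrite /series /= big_mkord; elim: m => [|m IH].
    apply: (cvg_seq_ext (g := fun=> 0)) (cvg_cst _) => // n.
    by rewrite !big_ord0 mul0r subrr.
  refine (cvg_seq_ext (g := fun n => (\sum_(k < m) p n k
      - (\sum_(k < m) exp_coeff lam k) * p n 0)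
    + (p n m - exp_coeff lam m * p n 0)) _ (esym (addr0 0)) _) => [n|].
    by rewrite !big_ord_recr /= mulrDl opprD addrACA.
  by apply: cvgD => //; exact: law_sub_poisson_cvg0.
have sE : series (exp_coeff lam) @ \oo --> expR lam.
  exact: is_cvg_series_exp_coeff.
have h : expR lam * p n 0 @[n --> \oo] --> (1 : R).
  apply/cvgrPdist_le => eps eps0.
  have e3 : 0 < eps / 3 by rewrite divr_gt0.
  have [m m1 m2] : exists2 m, `|series (exp_coeff lam) m - expR lam| <= eps / 3
     & lam + 1 <= m%:R * (eps / 3).
    have : \forall m \near \oo, `|series (exp_coeff lam) m - expR lam| <= eps / 3
     /\ lam + 1 <= m%:R * (eps / 3).
      near=> m; split.
        by rewrite distrC; near: m; move/cvgrPdist_le : sE; apply.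
      by rewrite -ler_pdivrMr //; near: m; exact: nbhs_infty_ger.
    by move=> [m _ /(_ m (leqnn m)) [? ?]]; exists m.
  have m0 : (0 : R) < m%:R.
    rewrite ltr0n lt0n; apply/eqP => m0; move: m2; rewrite m0 mul0r.
    by have := lam_ge0; lra.
  move/cvgr0Pnorm_le : (sum_lim m) => /(_ _ e3) h1.
  have hmu : \forall n \near \oo, mu n <= lam + 1.
    move/cvgrPdist_le : mu_lim => /(_ 1 ltr01); apply: filterS => n.
    by rewrite ler_norml => /andP[]; lra.
  near=> n.
  have mun : mu n <= lam + 1 by near: n.
  have h2 : `|\sum_(k < m) p n k - series (exp_coeff lam) m * p n 0| <= eps / 3.
    by near: n.
  have h3 : m%:R * (1 - \sum_(k < m) p n k) <= mu n by near: n; apply: filterS p_tail.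
  have h4 : 1 - \sum_(k < m) p n k <= eps / 3.
    by rewrite -(ler_pM2l m0); lra.
  have h5 : \sum_(k < m) p n k <= 1 by move: (m); near: n.
  have h6 : `|(series (exp_coeff lam) m - expR lam) * p n 0| <= eps / 3.
    rewrite normrM -[leRHS]mulr1; apply: ler_pM => //.
    by rewrite ger0_norm //; move: (0%N); near: n.
  move: h2 h6; rewrite !ler_norml mulrBl => /andP[? ?] /andP[? ?].
  by apply/andP; split; lra.
have E n : p n 0 = expR (- lam) * (expR lam * p n 0).
  by rewrite mulrA -expRD addNr expR0 mul1r.
refine (cvg_seq_ext E (esym (mulr1 _)) _).
exact: cvgMl_tmp.
Unshelve. all: by end_near. Qed.

Lemma poisson_limit k : p n k @[n --> \oo] --> exp_coeff lam k * expR (- lam).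
Proof.
have E n : p n k = (p n k - exp_coeff lam k * p n 0) + exp_coeff lam k * p n 0.
  by rewrite subrK.
refine (cvg_seq_ext E (esym (add0r _)) _); apply: cvgD; first exact: law_sub_poisson_cvg0.
by apply: cvgMl_tmp; exact: law_0_cvg.
Qed.

End PoissonLimit.

(** * Convergence in distribution to a law carried by an axis *)

Section Atoms.
Variables (R : realType) (d : measure_display) (T : measurableType d).
Variables (P : probability T R) (E : nat -> set T).
Hypothesis mE : forall k, measurable (E k).

Lemma bounded_integrable (h : T -> R) (M : R) : measurable_fun [set: T] h ->
  (forall w, `|h w| <= M) -> P.-integrable [set: T] (EFin \o h).
Proof.
move=> mh hM; apply: measurable_bounded_integrable => //.
  by apply: (le_lt_trans (probability_le1 P measurableT)); rewrite ltry.
exists M; split; first exact: num_real.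
by move=> x /ltW Mx w _; exact: le_trans (hM w) Mx.
Qed.

(** Also applied with h and a both equal to a constant M, to integrate the bound
    of [Rintegral_atoms]. *)
Lemma Rintegral_sub_atoms (h : T -> R) (a : nat -> R) m :
  P.-integrable [set: T] (EFin \o h) ->
  let g w := h w - \sum_(k < m) a k * \1_(E k) w in
  P.-integrable [set: T] (EFin \o g) /\
  \int[P]_w g w = \int[P]_w h w - \sum_(k < m) a k * fine (P (E k)).
Proof.
move=> ih; elim: m => [|m [ig Eg]] /=.
  have -> : (fun w => h w - \sum_(k < 0) a k * \1_(E k) w) = h.
    by apply/funext => w; rewrite big_ord0 subr0.
  by rewrite big_ord0 subr0.
have i1 : P.-integrable [set: T] (EFin \o (\1_(E m) : T -> R)).
  exact: integrable_indic.
have ia : P.-integrable [set: T] (EFin \o (fun w => a m * \1_(E m) w)).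
  apply: (@eq_integrable _ _ _ _ _ measurableT (fun w => (a m)%:E * (\1_(E m) w)%:E)%E) => //.
  exact: integrableZl.
set g := fun w => h w - \sum_(k < m) a k * \1_(E k) w in ig Eg.
have -> : (fun w => h w - \sum_(k < m.+1) a k * \1_(E k) w) =
    (fun w => g w - a m * \1_(E m) w).
  by apply/funext => w; rewrite big_ord_recr /= opprD addrA.
split; first exact: (integrableB measurableT ig ia).
rewrite RintegralB // Eg RintegralZl // big_ord_recr /= opprD addrA.
by rewrite [\int[P]_w \1_(E m) w]/Rintegral integral_indic // setIT.
Qed.

(** Once the values on the first m atoms are subtracted, h is left with a function
    bounded by M that vanishes on these atoms. *)
Lemma Rintegral_atoms (h : T -> R) (M : R) (a : nat -> R) m :
  measurable_fun [set: T] h -> (forall w, `|h w| <= M) ->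
  trivIset [set: nat] E -> (forall k w, E k w -> h w = a k) ->
  `|\int[P]_w h w - \sum_(k < m) a k * fine (P (E k))|
    <= M * (1 - \sum_(k < m) fine (P (E k))).
Proof.
move=> mh hM tE ha.
have [ig <-] := Rintegral_sub_atoms a m (bounded_integrable mh hM).
have iM : P.-integrable [set: T] (EFin \o (fun=> M)).
  exact: finite_measure_integrable_cst.
have [igM EgM] := Rintegral_sub_atoms (fun=> M) m iM.
have -> : M * (1 - \sum_(k < m) fine (P (E k))) =
    \int[P]_w (M - \sum_(k < m) M * \1_(E k) w).
  have PT : fine (P [set: T]) = 1 by rewrite probability_setT.
  by rewrite EgM Rintegral_cst // -mulr_sumr -mulrBr; congr (_ * (_ - _)).
apply: le_trans (le_normr_Rintegral _ ig) _ => //.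
apply: le_Rintegral => //; first exact: (integrable_abse ig).
move=> w _; rewrite -mulr_sumr.
have [[k km Ek]|nE] := pselect (exists2 k : 'I_m, true & E k w).
  have z (j : 'I_m) : j != k -> \1_(E j) w = 0 :> R.
    move=> jk; rewrite indicE memNset // => Ej; move/negP: jk; apply; apply/eqP.
    by apply/val_inj; apply: tE => //; exists w.
  rewrite (bigD1 k) //= [\sum_(k < m) _](bigD1 k) //= !indicE mem_set //.
  rewrite big1 => [|j /z ->]; last by rewrite mulr0.
  rewrite big1 => [|j /z -> //].
  by rewrite !addr0 !mulr1 (ha _ _ Ek) !subrr normr0.
have z (j : 'I_m) : \1_(E j) w = 0 :> R.
  by rewrite indicE memNset // => Ej; apply: nE; exists j.
rewrite big1 => [|j _]; last by rewrite z mulr0.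
by rewrite big1 => [|j _ //]; rewrite mulr0 !subr0.
Qed.

End Atoms.

(** Since the limit masses add up to 1, finitely many atoms carry almost all the
    mass of Q, hence also of P n for large n; by [Rintegral_atoms] the expectations
    are determined by these atoms up to a small error. *)
Lemma cvg_expectation_atoms (R : realType) (disp : nat -> measure_display)
    (T : forall n, measurableType (disp n)) (P : forall n, probability (T n) R)
    (d : measure_display) (T' : measurableType d) (Q : probability T' R)
    (h : forall n, T n -> R) (h' : T' -> R) (M : R) (a : nat -> R)
    (E : forall n, nat -> set (T n)) (E' : nat -> set T') :
  (forall n, measurable_fun [set: T n] (h n)) -> measurable_fun [set: T'] h' ->
  (forall n w, `|h n w| <= M) -> (forall w, `|h' w| <= M) ->
  (forall n k, measurable (E n k)) -> (forall k, measurable (E' k)) ->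
  (forall n, trivIset [set: nat] (E n)) -> trivIset [set: nat] E' ->
  (forall n k w, E n k w -> h n w = a k) -> (forall k w, E' k w -> h' w = a k) ->
  (forall k, fine (P n (E n k)) @[n --> \oo] --> fine (Q (E' k))) ->
  \sum_(k < m) fine (Q (E' k)) @[m --> \oo] --> (1 : R) ->
  'E_(P n)[h n]%E @[n --> \oo] --> 'E_Q[h']%E.
Proof.
move=> mh mh' hM hM' mE mE' tE tE' ha ha' EE' E'1.
have M0 : 0 <= M by apply: le_trans (hM' point); exact: normr_ge0.
have eqE : 'E_Q[h']%E = (\int[Q]_w h' w)%:E.
  rewrite unlock /Rintegral fineK //.
  by apply: integrable_fin_num => //; exact: bounded_integrable hM'.
have eqEn n : 'E_(P n)[h n]%E = (\int[P n]_w h n w)%:E.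
  rewrite unlock /Rintegral fineK //.
  by apply: integrable_fin_num => //; exact: bounded_integrable (hM n).
rewrite eqE; under eq_fun do rewrite eqEn.
apply: cvg_EFin; first by near=> n.
apply/cvgrPdist_le => eps eps0.
have e4 : 0 < eps / (4 * (M + 1)) by rewrite divr_gt0 // mulr_gt0 // ltr_wpDl.
have [m hm] : exists m, `|1 - \sum_(k < m) fine (Q (E' k))| <= eps / (4 * (M + 1)).
  by move/cvgrPdist_le : E'1 => /(_ _ e4)[m _ /(_ m (leqnn m)) ?]; exists m.
have sum_cvg (b : nat -> R) :
    \sum_(k < m) b k * fine (P n (E n k)) @[n --> \oo] -->
    \sum_(k < m) b k * fine (Q (E' k)).
  elim: (m) => [|j IH].
    by under eq_fun do rewrite big_ord0; rewrite big_ord0; exact: cvg_cst.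
  under eq_fun do rewrite big_ord_recr; rewrite big_ord_recr.
  by apply: cvgD => //; apply: cvgMl_tmp; exact: EE'.
move/cvgrPdist_le : (sum_cvg a) => /(_ (eps / 4)) ha4.
move/cvgrPdist_le : (sum_cvg (fun=> 1)) => /(_ _ e4) h14.
have hQ := Rintegral_atoms Q mE' m mh' hM' tE' ha'.
near=> n.
have hP := Rintegral_atoms (P n) (mE n) m (mh n) (hM n) (tE n) (ha n).
have h1 : `|\sum_(k < m) a k * fine (Q (E' k)) - \sum_(k < m) a k * fine (P n (E n k))| <= eps / 4.
  by near: n; apply: ha4; rewrite divr_gt0.
have h2 : `|\sum_(k < m) 1 * fine (Q (E' k)) - \sum_(k < m) 1 * fine (P n (E n k))|
    <= eps / (4 * (M + 1)) by near: n.
have one (F : nat -> R) : \sum_(k < m) 1 * F k = \sum_(k < m) F k.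
  by apply: eq_bigr => k _; rewrite mul1r.
rewrite (one (fun k => fine (Q (E' k)))) (one (fun k => fine (P n (E n k)))) in h2.
have Me : M * (eps / (4 * (M + 1))) <= eps / 4.
  have -> : eps / (4 * (M + 1)) = eps / 4 / (M + 1).
    by field; rewrite gt_eqF // ltr_wpDl.
  rewrite mulrA ler_pdivrMr ?ltr_wpDl // mulrC ler_wpM2l ?divr_ge0 ?ltW //.
  by rewrite ltrDl.
move: hQ hP h1 h2 hm; set s := \sum_(k < m) a k * _; set s' := \sum_(k < m) a k * _.
set t := \sum_(k < m) fine (Q _); set t' := \sum_(k < m) fine (P n _).
set x := Rintegral _ _ _; set y := Rintegral _ _ _.
move=> hQ hP h1 h2 hm.
have hQ' : `|x - s| <= eps / 4.
  apply: (le_trans hQ); apply: le_trans Me; apply: ler_wpM2l => //.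
  by apply: le_trans hm; exact: ler_norm.
have hP' : `|y - s'| <= eps / 2.
  apply: (le_trans hP); apply: (@le_trans _ _ (M * (2 * (eps / (4 * (M + 1)))))).
    apply: ler_wpM2l => //.
    by move: hm h2; rewrite !ler_norml => /andP[_ ?] /andP[_ ?]; lra.
  by rewrite mulrCA; lra.
move: hQ' hP' h1; rewrite !ler_norml => /andP[? ?] /andP[? ?] /andP[? ?].
by rewrite -[X in _ - X]/y; apply/andP; split; lra.
Unshelve. all: by end_near. Qed.

Lemma prob_subset_rare (d : measure_display) (T : measurableType d) (R : realType)
    (P : probability T R) (I : finType) (p : pred I) (E F : set T) (G : I -> set T) :
  measurable E -> measurable F -> (forall i, measurable (G i)) ->
  E `<=` F -> (forall w, F w -> ~ E w -> exists2 i, p i & G i w) ->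
  `|fine (P F) - fine (P E)| <= \sum_(i | p i) fine (P (G i)).
Proof.
move=> mE mF mG EF FE; pose U := \big[setU/set0]_(i | p i) G i.
have mU : measurable U by exact: bigsetU_measurable.
have PU : (P U <= \sum_(i | p i) P (G i))%E.
  suff [] : measurable U /\ (P U <= \sum_(i | p i) P (G i))%E by [].
  rewrite /U; elim/big_rec2 : _ => [|i x B _ [mB IH]].
    by rewrite measure0.
  split; first exact: measurableU.
  by apply: le_trans (measureU2 _ _ _) _ => //; exact: leeD2l.
have h1 : (P E <= P F)%E by rewrite le_measure // inE.
have h2 : (P F <= P E + P U)%E.
  apply: le_trans (measureU2 _ _ _) => //; apply: le_measure; rewrite ?inE //.
    exact: measurableU.
  move=> w Fw; have [|nE] := pselect (E w); [by left|right].
  have [i pi Gi] := FE w Fw nE.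
  by rewrite /U (bigD1 i) //=; left.
have fP (B : set T) : measurable B -> P B = (fine (P B))%:E.
  by move=> mB; rewrite fineK //; exact: fin_num_measure.
move: h1 h2 PU; rewrite (eq_bigr (fun i => (fine (P (G i)))%:E)); last first.
  by move=> i _; exact: fP.
rewrite (fP _ mE) (fP _ mF) (fP _ mU) sumEFin -EFinD !lee_fin => h1 h2 h3.
by rewrite ger0_norm ?subr_ge0 //; lra.
Qed.

Lemma cvg_sum0 (R : realType) (I : finType) (p : pred I) (u : nat -> I -> R) :
  (forall i, p i -> u n i @[n --> \oo] --> (0 : R)) ->
  \sum_(i | p i) u n i @[n --> \oo] --> (0 : R).
Proof.
move=> h; elim: (index_enum I) => [|i s IH].
  by refine (cvg_seq_ext _ erefl (cvg_cst (0 : R))) => n; rewrite big_nil.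
have [pi|npi] := boolP (p i).
  refine (cvg_seq_ext (g := fun n => u n i + \sum_(j <- s | p j) u n j) _
    (esym (addr0 0)) _) => [n|]; first by rewrite big_cons pi.
  by apply: cvgD => //; exact: h.
by refine (cvg_seq_ext _ erefl IH) => n; rewrite big_cons (negbTE npi).
Qed.

(** The atoms are the points of the axis of coordinate i0 with entry k there and 0
    elsewhere. The event that the vector is this point and the event that coordinate
    i0 equals k differ only where another coordinate is nonzero, which has probability
    tending to 0, and probability 0 in the limit. *)
Lemma cvg_in_distribution_one_coord (R : realType)
    (disp : nat -> measure_display) (T : forall n, measurableType (disp n))
    (P : forall n, probability (T n) R)
    (disp' : measure_display) (T' : measurableType disp') (Q : probability T' R)
    (m : nat) (i0 : 'I_m) (Y : forall n, 'I_m -> T n -> nat) (Y' : 'I_m -> T' -> nat)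
    (p : nat -> R) :
  (forall n i, measurable_fun [set: T n] (Y n i)) ->
  (forall i, measurable_fun [set: T'] (Y' i)) ->
  (forall k, fine (P n [set w | Y n i0 w = k]) @[n --> \oo] --> p k) ->
  (forall k, fine (Q [set w | Y' i0 w = k]) = p k) ->
  \sum_(k < n) p k @[n --> \oo] --> (1 : R) ->
  (forall i, i != i0 -> fine (P n [set w | Y n i w <> 0%N]) @[n --> \oo] --> (0 : R)) ->
  (forall i, i != i0 -> fine (Q [set w | Y' i w <> 0%N]) = 0) ->
  cvg_in_distribution P Q (fun n w => \row_i (Y n i w)%:R : 'rV[R]_m)
    (fun w => \row_i (Y' i w)%:R : 'rV[R]_m).
Proof.
move=> mY mY' Pk Qk p1 P0 Q0 f cf [M0 [_ bM]].
have fM x : `|f x| <= M0 + 1 by apply: bM => //; rewrite ltrDl.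
pose axis k : {ffun 'I_m -> nat} := [ffun i => if i == i0 then k else 0%N].
have mev n (B : set {ffun 'I_m -> nat}) : measurable [set w | B [ffun i => Y n i w]].
  exact: measurable_ffun_preimage.
have mev' (B : set {ffun 'I_m -> nat}) : measurable [set w | B [ffun i => Y' i w]].
  exact: measurable_ffun_preimage.
have rowE (y : 'I_m -> nat) : \row_i (y i)%:R = \row_i ([ffun i => y i] i)%:R :> 'rV[R]_m.
  by apply/rowP => i; rewrite !mxE ffunE.
pose E n k := [set w : T n | [ffun i => Y n i w] = axis k].
pose E' k := [set w : T' | [ffun i => Y' i w] = axis k].
have mE n k : measurable (E n k) by exact: (mev n [set axis k]).
have mE' k : measurable (E' k) by exact: (mev' [set axis k]).
have axis_inj k k' : axis k = axis k' -> k = k'.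
  by move=> /ffunP/(_ i0); rewrite !ffunE eqxx.
have close (D : measure_display) (S : measurableType D) (mu : probability S R)
    (y : 'I_m -> S -> nat) k : (forall i, measurable_fun [set: S] (y i)) ->
    `|fine (mu [set w | y i0 w = k]) - fine (mu [set w | [ffun i => y i w] = axis k])|
    <= \sum_(i | i != i0) fine (mu [set w | y i w <> 0%N]).
  move=> my; apply: prob_subset_rare.
  - exact: (measurable_ffun_preimage [set axis k]).
  - by have := my i0 measurableT [set k] I; rewrite setTI.
  - by move=> i; have := my i measurableT [set j | j <> 0%N] I; rewrite setTI.
  - by move=> w /= /ffunP/(_ i0); rewrite !ffunE eqxx.
  - move=> w /= yk ne; apply: contrapT => h; apply: ne; apply/ffunP => i.
    rewrite !ffunE; case: eqVneq => [->//|ii0].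
    by apply: contrapT => yi; apply: h; exists i.
have QE' k : fine (Q (E' k)) = p k.
  apply/eqP; rewrite eq_sym -subr_eq0 -normr_le0 -Qk.
  by apply: le_trans (close _ _ Q Y' k mY') _; rewrite big1.
apply: (@cvg_expectation_atoms R disp T P _ T' Q _ _ (M0 + 1)
  (fun k => f (\row_i (axis k i)%:R)) E E') => //.
- move=> n _ B mB; rewrite setTI.
  have := mev n [set phi | B (f (\row_i (phi i)%:R))].
  by congr measurable; apply/seteqP; split => w /=; rewrite -rowE.
- move=> _ B mB; rewrite setTI.
  have := mev' [set phi | B (f (\row_i (phi i)%:R))].
  by congr measurable; apply/seteqP; split => w /=; rewrite -rowE.
- by move=> n w; exact: fM.
- by move=> w; exact: fM.
- by move=> n k k' _ _ [w [e e']]; apply: axis_inj; exact: etrans (esym e) e'.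
- by move=> k k' _ _ [w [e e']]; apply: axis_inj; exact: etrans (esym e) e'.
- by move=> n k w Ew; congr f; apply/rowP => i; rewrite !mxE -Ew ffunE.
- by move=> k w Ew; congr f; apply/rowP => i; rewrite !mxE -Ew ffunE.
- move=> k; rewrite QE'.
  have s0 : \sum_(i | i != i0) fine (P n [set w | Y n i w <> 0%N]) @[n --> \oo] --> (0 : R).
    exact: cvg_sum0.
  apply/cvgrPdist_le => eps eps0.
  have e2 : 0 < eps / 2 by rewrite divr_gt0.
  move/cvgrPdist_le : (Pk k) => /(_ _ e2) h1.
  move/cvgr0Pnorm_le : s0 => /(_ _ e2) h2.
  near=> n.
  have := close _ _ (P n) (Y n) k (mY n).
  have : `|p k - fine (P n [set w | Y n i0 w = k])| <= eps / 2 by near: n.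
  have : `|\sum_(i | i != i0) fine (P n [set w | Y n i w <> 0%N])| <= eps / 2 by near: n.
  set s := \sum_(i | _) _; rewrite -/(E n k) !ler_norml => /andP[? ?] /andP[? ?] /andP[? ?].
  by apply/andP; split; lra.
- by under eq_fun do under eq_bigr do rewrite QE'.
Unshelve. all: by end_near. Qed.

(** * Asymptotics of the progression counts *)

(** At rate 0 both sides are 1 for k = 0 and 0 otherwise, because 0 ^+ 0 = 1. *)
Lemma poisson_law_atom (d : measure_display) (T : measurableType d)
    (R : realType) (P : probability T R) (Z : {RV P >-> nat}) (rate : R) k :
  0 <= rate -> has_poisson_law Z rate ->
  P [set w | Z w = k] = (exp_coeff rate k * expR (- rate))%:E.
Proof.
move=> rate_ge0 /(_ [set k]); rewrite /distribution /pushforward /poisson_prob.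
rewrite (_ : Z @^-1` [set k] = [set w | Z w = k]) // => ->.
case: ltP => [rate_gt0|rate_le0].
  rewrite esum_set1; last by rewrite lee_fin poisson_pmf_ge0.
  by rewrite /poisson_pmf rate_gt0.
have -> : rate = 0 by apply/eqP; rewrite eq_le rate_le0.
rewrite oppr0 expR0 mulr1 diracE /exp_coeff /=.
case: k => [|k]; first by rewrite mem_set // expr0 fact0 divr1.
by rewrite memNset ?expr0n ?mul0r.
Qed.


Lemma cvg_poisson_mass (R : realType) (lam : R) :
  \sum_(k < n) exp_coeff lam k * expR (- lam) @[n --> \oo] --> (1 : R).
Proof.
have e1 : expR lam * expR (- lam) = 1 by rewrite -expRD subrr expR0.
refine (cvg_seq_ext (g := fun n => series (exp_coeff lam) n * expR (- lam)) _ (esym e1) _).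
  by move=> n; rewrite /series /= big_mkord mulr_suml.
by apply: cvgMr_tmp; exact: is_cvg_series_exp_coeff.
Qed.

Section Asymptotics.
Variables (R : realType) (A : nat -> {fset nat}) (c : nat -> nat).
Variables (disp : nat -> measure_display) (T : forall n, measurableType (disp n)).
Variables (P : forall n, probability (T n) R) (X : forall n, T n -> nat -> nat).
Arguments X : clear implicits.
Hypothesis c_infty : c n @[n --> \oo] --> \oo.
Hypothesis X_unif : forall n, uniform_random_coloring (P n) (A n) (c n) (X n).

Let W r n w := num_mono_AP r (A n) (X n w).
Let mean r n : R := #|{: APs (A n) r}|%:R / (c n)%:R ^+ r.-1.

Lemma near_colors_gt m : \forall n \near \oo, (m < c n)%N.
Proof. exact: (c_infty (nbhs_infty_gt m)). Qed.

Lemma cvg_colors_inv : ((c n)%:R)^-1 @[n --> \oo] --> (0 : R).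
Proof.
apply/cvgr0Pnorm_le => eps eps0.
have h : \forall n \near \oo, eps^-1 <= (c n)%:R.
  exact: (c_infty (nbhs_infty_ger eps^-1)).
near=> n; have cn : eps^-1 <= (c n)%:R by near: n.
have c0 : 0 < (c n)%:R :> R by apply: lt_le_trans cn; rewrite invr_gt0.
by rewrite normfV ger0_norm // -[eps]invrK lef_pV2 ?posrE // invr_gt0.
Unshelve. all: by end_near. Qed.

Lemma cvg_mean r (lam : R) : (0 < r)%N ->
  'E_(P n)[fun w => (W r w)%:R]%E @[n --> \oo] --> lam%:E ->
  mean r n @[n --> \oo] --> lam.
Proof.
move=> r0 /fine_cvg; apply: cvg_trans; apply: near_eq_cvg.
near=> n; have cn : (0 < c n)%N by near: n; exact: near_colors_gt.
by rewrite /= (expectation_num_mono_AP (X_unif n) cn r0).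
Unshelve. all: by end_near. Qed.

(** There are at most as many r-term as 3-term progressions, and each longer one is
    less likely to be monochromatic by a factor of at least c. *)
Lemma mean_le r n : (3 < r)%N -> (0 < c n)%N -> mean r n <= mean 3%N n / (c n)%:R.
Proof.
move=> r3 cn; have c0 : 0 < (c n)%:R :> R by rewrite ltr0n.
rewrite /mean -mulrA -invfM -exprSr; apply: ler_pM => //.
- by rewrite ler_nat card_APs_le // ltnW.
- rewrite lef_pV2 ?posrE ?exprn_gt0 // ler_weXn2l ?ler1n //.
  by case: r r3.
Qed.

Lemma cvg_mean_long r (lam : R) : (3 < r)%N ->
  mean 3%N n @[n --> \oo] --> lam -> mean r n @[n --> \oo] --> (0 : R).
Proof.
move=> r3 h; apply: (@squeeze_cvgr _ _ _ _ (fun=> 0) (fun n => mean 3%N n / (c n)%:R)).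
- near=> n; rewrite divr_ge0 ?exprn_ge0 //= mean_le //.
  by near: n; exact: near_colors_gt.
- exact: cvg_cst.
- refine (cvg_seq_ext (fun=> erefl) (esym (mulr0 lam)) _).
  by apply: cvgM => //; exact: cvg_colors_inv.
Unshelve. all: by end_near. Qed.

Lemma prob_nonzero_le_mean r n : (0 < r)%N -> (0 < c n)%N ->
  fine (P n [set w | W r w <> 0%N]) <= mean r n.
Proof.
move=> r0 cn.
have := mono_count_law_tail R cn r0 (@card_AP_edge (A n) r) 1.
rewrite mul1r big_ord1 /mean; apply: le_trans.
have -> : [set w | W r w <> 0%N] = ~` [set w | W r w = 0%N] by [].
rewrite probability_setC ?(prob_num_mono_AP (X_unif n) cn) //.
have mW : measurable_fun [set: T n] (fun w => W r w).
  exact: measurable_num_mono_AP (X_unif n) r.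
by have := mW measurableT [set 0%N] I; rewrite setTI.
Qed.

(** The hypergraph of 3-term progressions satisfies [mono_count_law_rec] with K = 3
    and, by [cvg_mean], mu tending to lam. *)
Lemma cvg_prob_three (lam : R) k : 0 <= lam -> mean 3%N n @[n --> \oo] --> lam ->
  fine (P n [set w | W 3%N w = k]) @[n --> \oo] --> exp_coeff lam k * expR (- lam).
Proof.
move=> lam0 h3.
have : mono_count_law R (c n) (@AP_edge (A n) 3) k @[n --> \oo] -->
    exp_coeff lam k * expR (- lam).
  have hc := cvg_colors_inv.
  apply: (@poisson_limit R (fun n k => mono_count_law R (c n) (@AP_edge (A n) 3) k)
    (mean 3%N) (fun n => (5%:R * mean 3%N n + 18%:R * 3%:R * mean 3%N n ^+ 2
       + 9%:R * 3%:R * mean 3%N n) / (c n)%:R) lam) => //.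
  - refine (cvg_seq_ext (fun=> erefl) (esym (mulr0 (5%:R * lam + 18%:R * 3%:R * lam ^+ 2
       + 9%:R * 3%:R * lam))) _).
    apply: cvgM => //; apply: cvgD; first apply: cvgD.
    + exact: cvgMl_tmp.
    + by apply: cvgMl_tmp; exact: (cvgM h3 h3).
    + exact: cvgMl_tmp.
  - by move=> n j; exact: mono_count_law_ge0.
  - near=> n => j; apply: mono_count_law_rec.
    + by near: n; exact: near_colors_gt.
    + exact: card_AP_edge.
    + exact: AP_edge_inj.
    + exact: AP_edge_codegree.
  - near=> n => m; apply: sum_mono_count_law_le1.
    by near: n; exact: near_colors_gt.
  - near=> n => m; apply: mono_count_law_tail => //; last exact: card_AP_edge.
    by near: n; exact: near_colors_gt.
apply: cvg_trans; apply: near_eq_cvg; near=> n.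
have cn : (0 < c n)%N by near: n; exact: near_colors_gt.
by rewrite (prob_num_mono_AP (X_unif n) cn).
Unshelve. all: by end_near. Qed.

End Asymptotics.

Theorem mainTheorem8 (R : realType) (d : nat) (d_ge3 : (3 <= d)%N)
    (A : nat -> {fset nat}) (c : nat -> nat)
    (A_sub : forall n x, x \in A n -> (1 <= x <= n)%N)
    (A_infty : #|` A n| @[n --> \oo] --> \oo)
    (c_infty : c n @[n --> \oo] --> \oo)
    (disp : nat -> measure_display) (T : forall n, measurableType (disp n))
    (P : forall n, probability (T n) R)
    (X : forall n, T n -> nat -> nat)
    (X_unif : forall n, uniform_random_coloring (P n) (A n) (c n) (@X n))
    (lambda : nat -> R)
    (lambda_ge0 : forall r, (3 <= r <= d)%N -> 0 <= lambda r)
    (E_lim : forall r, (3 <= r <= d)%N ->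
      'E_(P n)[fun w => (num_mono_AP r (A n) (X n w))%:R]%E
        @[n --> \oo] --> (lambda r)%:E)
    (V_lim : forall r, (3 <= r <= d)%N ->
      'V_(P n)[fun w => (num_mono_AP r (A n) (X n w))%:R]%E
        @[n --> \oo] --> (lambda r)%:E)
    (disp' : measure_display) (T' : measurableType disp')
    (Q : probability T' R) (Z : nat -> {RV Q >-> nat})
    (Z_law : forall r, (3 <= r <= d)%N -> has_poisson_law (Z r) (lambda r))
    (Z_indep : mutually_independent Q [set r | (3 <= r <= d)%N]
      (fun r => Z r : T' -> nat)) :
  cvg_in_distribution P Q
    (fun n w => \row_(i < d - 2) (num_mono_AP (i + 3) (A n) (X n w))%:R : 'rV[R]_(d - 2))
    (fun w => \row_(i < d - 2) (Z (i + 3)%N w)%:R : 'rV[R]_(d - 2)).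
Proof.
(* Coordinate i counts progressions of length i + 3: coordinate i0 = 0 carries the
   Poisson limit, all others tend to 0. *)
have i0P : (0 < d - 2)%N by lia.
pose i0 := Ordinal i0P.
have rd (i : 'I_(d - 2)) : (3 <= i + 3 <= d)%N by have := ltn_ord i; lia.
have long (i : 'I_(d - 2)) : i != i0 -> (3 < i + 3)%N.
  by rewrite -val_eqE /=; lia.
have mean_lim r : (3 <= r <= d)%N ->
    #|{: APs (A n) r}|%:R / (c n)%:R ^+ r.-1 @[n --> \oo] --> lambda r.
  by move=> hr; apply: (cvg_mean c_infty X_unif); [lia|exact: E_lim].
have r3 : (3 <= 3 <= d)%N by [].
have h3 := mean_lim _ r3.
have lam0 (i : 'I_(d - 2)) : i != i0 -> lambda (i + 3)%N = 0.
  move=> ii0; apply: (cvg_unique _ (mean_lim _ (rd i))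
    (cvg_mean_long c_infty (long i ii0) h3)).
  exact: norm_hausdorff.
apply: (@cvg_in_distribution_one_coord R disp T P disp' T' Q (d - 2) i0
  (fun n i w => num_mono_AP (i + 3) (A n) (X n w)) (fun i => Z (i + 3)%N)
  (fun k => exp_coeff (lambda 3%N) k * expR (- lambda 3%N))).
- by move=> n i; exact: measurable_num_mono_AP.
- by move=> i.
- by move=> k; exact: (cvg_prob_three c_infty X_unif (lambda_ge0 _ r3) h3).
- by move=> k; rewrite (poisson_law_atom _ (lambda_ge0 _ r3)) //; exact: Z_law.
- exact: cvg_poisson_mass.
- move=> i ii0; apply: (@squeeze_cvgr _ _ _ _ (fun=> 0)
    (fun n => #|{: APs (A n) (i + 3)}|%:R / (c n)%:R ^+ (i + 3).-1)).
  + near=> n; rewrite fine_ge0 //=; apply: prob_nonzero_le_mean => //.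
      by lia.
    by near: n; exact: near_colors_gt.
  + exact: cvg_cst.
  + by rewrite -(lam0 i ii0); exact: mean_lim.
- move=> i ii0.
  have -> : [set w | Z (i + 3)%N w <> 0%N] = ~` [set w | Z (i + 3)%N w = 0%N] by [].
  rewrite probability_setC; last first.
    have mZ : measurable_fun [set: T'] (Z (i + 3)%N) by [].
    by have := mZ measurableT [set 0%N] I; rewrite setTI.
  rewrite (poisson_law_atom _ (lambda_ge0 _ (rd i))) ?lam0 //; last first.
    by rewrite -(lam0 i ii0); exact: Z_law.
  by rewrite /exp_coeff /= expr0 fact0 divr1 oppr0 expR0 mul1r /= subrr.
Unshelve. all: by end_near. Qed.
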